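(* Every spherical disk graph has a vertex whose neighborhood is the union of $6$ cliques.
   Context: Graphs are finite, simple and have at least one vertex. The neighborhood of a vertex $v$ is the set of vertices adjacent to $v$; cliques are sets of pairwise adjacent vertices, and in ''union of $6$ cliques'' the cliques may overlap or be empty (i.e. the neighborhood induces a subgraph with clique cover number at most $6$). On the unit sphere $\mathbb{S}^2\subset\mathbb{R}^3$ with spherical distance $d_{\mathbb{S}^2}(a,b)$ (the angle between vectors $a$ and $b$), the spherical disk of radius $r\in(0,\pi)$ centered at $v$ is $\{u\in\mathbb{S}^2: d_{\mathbb{S}^2}(u,v)\le r\}$. A spherical disk graph is the intersection graph of a finite collection of spherical disks, with radii not necessarily equal (vertices are the disks, two distinct ones adjacent iff they intersect). *)

(* Defs.v *)
From HB Require Import structures.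
From mathcomp Require Import all_boot all_order all_algebra.
From mathcomp Require Import all_classical all_reals all_analysis.

Set Implicit Arguments.
Unset Strict Implicit.
Unset Printing Implicit Defensive.

Import Order.TTheory GRing.Theory Num.Theory.

Local Open Scope classical_set_scope.
Local Open Scope ring_scope.

Section SphericalDisks.
Context {R : realType}.
Implicit Types a b u v : 'rV[R]_3.

Definition dot3 a b : R := \sum_(i < 3) a 0 i * b 0 i.

(* The library's norm on 'rV[R]_3 is the max norm, hence this definition. *)
Definition enorm3 a : R := Num.sqrt (dot3 a a).

Definition sphere2 : set 'rV[R]_3 := [set u | enorm3 u = 1].

Definition sphere_dist a b : R := acos (dot3 a b / (enorm3 a * enorm3 b)).

Definition spherical_disk v (r : R) : set 'rV[R]_3 :=
  [set u | sphere2 u /\ sphere_dist u v <= r].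

End SphericalDisks.

Section Graphs.
Variable V : finType.
Implicit Types e : rel V.

Definition simple_graph e : Prop := symmetric e /\ irreflexive e.

Definition neighborhood e (v : V) : {set V} := [set w | e v w].

Definition clique e (K : {set V}) : Prop :=
  {in K &, forall x y, x != y -> e x y}.

Definition union_of_cliques e (k : nat) (A : {set V}) : Prop :=
  exists K : 'I_k -> {set V},
    (forall i, clique e (K i)) /\ A = (\bigcup_(i < k) K i)%SET.

(* The disks form a family indexed by the vertices: distinct vertices may carry
   the same disk, and are then adjacent. *)
Definition spherical_disk_graph (R : realType) e : Prop :=
  exists (c : V -> 'rV[R]_3) (r : V -> R),
    [/\ forall x, sphere2 (c x),
        forall x, 0 < r x < pi
      & forall x y, e x y <->
          x != y /\
          (spherical_disk (c x) (r x) `&` spherical_disk (c y) (r y)) !=set0].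

End Graphs.

Arguments spherical_disk_graph {V} R e.

(* Main.v *)
(** Pick a disk of least radius [r] with center [v].  Split the tangent plane at
    [v] into six sectors of angle pi/3 and group the neighbors according to the
    sector containing the projection of their center.  If the angle at [v] of a
    spherical triangle [v a b] is at most pi/3, then
    [d(a,b) <= max (d(a,v)) (d(b,v))]; for two neighbors of radii [ra], [rb] in
    the same sector this maximum is at most [r + max ra rb <= ra + rb], so their
    disks meet. *)
Require Import Defs.
From mathcomp Require Import all_boot all_order all_algebra.
From mathcomp Require Import all_classical all_reals all_analysis.
From mathcomp Require Import ring lra.

Set Implicit Arguments.
Unset Strict Implicit.
Unset Printing Implicit Defensive.

Import Order.TTheory GRing.Theory Num.Theory.

Local Open Scope classical_set_scope.
Local Open Scope ring_scope.

Section Sphere.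
Context {R : realType}.
Implicit Types a b u v p q : 'rV[R]_3.

(** * Real inequalities and vector algebra in dimension three *)

Lemma ler_norm_sqr (x y : R) : 0 <= y -> (`|x| <= y) = (x ^+ 2 <= y ^+ 2).
Proof.
by move=> y0; rewrite -(@ler_pXn2r _ 2)// ?nnegrE// real_normK ?num_real.
Qed.

Lemma ler_cos : {in `[0, pi] &, {mono (@cos R) : x y /~ y <= x}}.
Proof. by move=> x y x0 y0; rewrite !leNgt ltr_cos. Qed.

Lemma dot3E a b :
  dot3 a b = a 0 0 * b 0 0 + a 0 1 * b 0 1 + a 0 2%:R * b 0 2%:R.
Proof.
rewrite /dot3 !big_ord_recl big_ord0 addr0 addrA.
by congr (_ * _ + _ * _ + _ * _); congr (_ _ _); apply/val_inj.
Qed.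

Lemma dot3C a b : dot3 a b = dot3 b a.
Proof. by apply: eq_bigr => i _; rewrite mulrC. Qed.

Lemma dot3_lincombl (s t : R) a b u :
  dot3 (s *: a + t *: b) u = s * dot3 a u + t * dot3 b u.
Proof. by rewrite !dot3E !mxE; ring. Qed.

Lemma sphere2P u : sphere2 u <-> dot3 u u = 1.
Proof.
rewrite /sphere2 /enorm3 /=; split=> [u1|->]; last by rewrite sqrtr1.
rewrite -[LHS]sqr_sqrtr ?u1 ?expr1n// /dot3 sumr_ge0// => i _.
by rewrite -expr2 sqr_ge0.
Qed.

Definition row3 (x y z : R) : 'rV[R]_3 := \row_j nth 0 [:: x; y; z] j.

Definition cross3 a b : 'rV[R]_3 :=
  row3 (a 0 1 * b 0 2%:R - a 0 2%:R * b 0 1)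
       (a 0 2%:R * b 0 0 - a 0 0 * b 0 2%:R)
       (a 0 0 * b 0 1 - a 0 1 * b 0 0).

(** [v], [p] and [cross3 v p] form an orthonormal frame. The polynomial identity in the proof holds
    for arbitrary [v] and [p], scaled by their Gram determinant. *)
Lemma parseval_cross3 v p a b :
  dot3 v v = 1 -> dot3 p p = 1 -> dot3 v p = 0 ->
  dot3 a b = dot3 a v * dot3 b v + dot3 a p * dot3 b p
             + dot3 a (cross3 v p) * dot3 b (cross3 v p).
Proof.
move=> vv pp vp.
have : dot3 a b * (dot3 v v * dot3 p p - dot3 v p ^+ 2) =
    dot3 p p * (dot3 a v * dot3 b v)
    - dot3 v p * (dot3 a v * dot3 b p + dot3 a p * dot3 b v)
    + dot3 v v * (dot3 a p * dot3 b p)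
    + dot3 a (cross3 v p) * dot3 b (cross3 v p).
  by rewrite !dot3E !mxE /=; ring.
by rewrite vv pp vp => E; lra.
Qed.

Lemma exists_unit_orthogonal v : exists p, dot3 p p = 1 /\ dot3 v p = 0.
Proof.
set n := v 0 0 ^+ 2 + v 0 1 ^+ 2.
have n_ge0 : 0 <= n by rewrite addr_ge0 ?sqr_ge0.
(* On the third axis the first basis vector serves; elsewhere the horizontal part of [v] is turned
   by a right angle and normalized. *)
have [n0|n_neq0] := eqVneq n 0.
  have v0 : v 0 0 = 0.
    apply/eqP; rewrite -sqrf_eq0; move/eqP: n0.
    by rewrite paddr_eq0 ?sqr_ge0// => /andP[].
  by exists (row3 1 0 0); rewrite !dot3E !mxE /= v0; split; ring.
have sn : Num.sqrt n ^+ 2 = n by rewrite sqr_sqrtr.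
have s0 : Num.sqrt n != 0.
  by rewrite sqrtr_eq0 -ltNge lt_neqAle eq_sym n_neq0.
exists ((Num.sqrt n)^-1 *: row3 (- v 0 1) (v 0 0) 0).
split; rewrite !dot3E !mxE /=; last by ring.
rewrite [LHS](_ : _ = (Num.sqrt n ^+ 2)^-1 * n); last by rewrite /n; field.
by rewrite sn mulVf.
Qed.


(** Cauchy-Schwarz, from Lagrange's identity for the cross product. *)
Lemma dot3_unit_bounds a b :
  dot3 a a = 1 -> dot3 b b = 1 -> -1 <= dot3 a b <= 1.
Proof.
move=> aa bb; have : dot3 a a * dot3 b b - dot3 a b ^+ 2
    = dot3 (cross3 a b) (cross3 a b) by rewrite !dot3E !mxE /=; ring.
rewrite aa bb mulr1 (dot3E (cross3 a b)) -!expr2 => E.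
rewrite -ler_norml ler_norm_sqr//.
by rewrite expr1n -subr_ge0 E !addr_ge0 ?sqr_ge0.
Qed.

(** * Spherical distance and its triangle inequality *)

Lemma sphere_distE a b :
  sphere2 a -> sphere2 b -> sphere_dist a b = acos (dot3 a b).
Proof. by rewrite /sphere_dist => -> ->; rewrite mulr1 divr1. Qed.

Lemma acos_leP (x t : R) :
  -1 <= x <= 1 -> 0 <= t <= pi -> (acos x <= t) = (cos t <= x).
Proof.
move=> x1 tpi; rewrite -{2}(acosK (x := x)) ?in_itv//=.
by rewrite ler_cos ?in_itv//= acos_ge0// acos_lepi.
Qed.

Lemma sphere_dist_ge0 a b : sphere2 a -> sphere2 b -> 0 <= sphere_dist a b.
Proof.
move=> a1 b1; rewrite sphere_distE// acos_ge0// dot3_unit_bounds//;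
  exact/sphere2P.
Qed.

Lemma sphere_dist_le_pi a b : sphere2 a -> sphere2 b -> sphere_dist a b <= pi.
Proof.
move=> a1 b1; rewrite sphere_distE// acos_lepi// dot3_unit_bounds//;
  exact/sphere2P.
Qed.

Lemma cos_sphere_dist a b :
  sphere2 a -> sphere2 b -> cos (sphere_dist a b) = dot3 a b.
Proof.
move=> a1 b1; rewrite sphere_distE// acosK// in_itv/= dot3_unit_bounds//;
  exact/sphere2P.
Qed.

Lemma sphere_dist_leP a b (t : R) : sphere2 a -> sphere2 b -> 0 <= t <= pi ->
  (sphere_dist a b <= t) = (cos t <= dot3 a b).
Proof.
move=> a1 b1 tpi; rewrite sphere_distE// acos_leP// dot3_unit_bounds//;
  exact/sphere2P.
Qed.

Lemma sphere_distC a b : sphere2 a -> sphere2 b ->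
  sphere_dist a b = sphere_dist b a.
Proof. by move=> a1 b1; rewrite !sphere_distE// dot3C. Qed.

Lemma sphere_dist_triangle u a b : sphere2 u -> sphere2 a -> sphere2 b ->
  sphere_dist a b <= sphere_dist u a + sphere_dist u b.
Proof.
move=> u1 a1 b1.
(* Cosines may be compared only on [[0, pi]]; a larger sum exceeds every distance. *)
have [sum_pi|sum_pi] := leP (sphere_dist u a + sphere_dist u b) pi; last by rewrite (le_trans (sphere_dist_le_pi a1 b1))// ltW.
rewrite sphere_dist_leP// ?addr_ge0 ?sphere_dist_ge0//=.
rewrite cosD !cos_sphere_dist//.
set sa := sin _; set sb := sin _.
have sab : 0 <= sa * sb.
  by rewrite mulr_ge0// sin_ge0_pi// sphere_dist_ge0// sphere_dist_le_pi.
have sa2 : sa ^+ 2 = 1 - dot3 u a ^+ 2 by rewrite /sa sin2cos2 cos_sphere_dist.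
have sb2 : sb ^+ 2 = 1 - dot3 u b ^+ 2 by rewrite /sb sin2cos2 cos_sphere_dist.
(* The Gram determinant of [u], [a], [b] is the square of their determinant. *)
have : 0 <= dot3 u (cross3 a b) ^+ 2 by exact: sqr_ge0.
have -> : dot3 u (cross3 a b) ^+ 2 =
    dot3 u u * (dot3 a a * dot3 b b - dot3 a b ^+ 2)
    + 2 * dot3 a b * dot3 u a * dot3 u b
    - dot3 u a ^+ 2 * dot3 b b - dot3 u b ^+ 2 * dot3 a a.
  by rewrite !dot3E !mxE /=; ring.
move/sphere2P: u1 => ->; move/sphere2P: a1 => ->; move/sphere2P: b1 => ->.
move=> gram.
have : (dot3 u a * dot3 u b - dot3 a b) ^+ 2 <= (sa * sb) ^+ 2.
  by rewrite exprMn sa2 sb2; nra.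
rewrite -ler_norm_sqr// => h.
by have := le_trans (ler_norm _) h; lra.
Qed.

(** * Intersection of two disks in terms of the distance of their centers *)

Lemma spherical_disks_meet a b (ra rb : R) :
  sphere2 a -> sphere2 b -> 0 < ra < pi -> 0 < rb < pi ->
  sphere_dist a b <= ra + rb ->
  (spherical_disk a ra `&` spherical_disk b rb) !=set0.
Proof.
move=> a1 b1 /andP[ra0 rapi] /andP[rb0 rbpi].
have /sphere2P aa := a1; have /sphere2P bb := b1.
set d := sphere_dist a b => d_le.
have self (x : 'rV[R]_3) : sphere2 x -> sphere_dist x x = 0.
  by move=> x1; rewrite sphere_distE//; move/sphere2P: x1 => ->; rewrite acos1.
have [d_ra|ra_d] := leP d ra.
  exists b; split; split => //; last by rewrite self// ltW.
  by rewrite sphere_distC.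
have d_pi : d <= pi by exact: sphere_dist_le_pi.
have cosd : cos d = dot3 a b by exact: cos_sphere_dist.
(* [p] is the unit tangent vector at [a] pointing towards [b]. *)
have [p [pp ap bp]] : exists p,
    [/\ dot3 p p = 1, dot3 a p = 0 & dot3 p b = sin d].
  (* For antipodal centers [b = - a] and [sin d = 0], so any unit tangent vector at [a] will do. *)
  have [d_eq|d_neq] := eqVneq d pi.
    have [p [pp ap]] := exists_unit_orthogonal a; exists p; split => //.
    have : dot3 (1 *: a + 1 *: b) (1 *: a + 1 *: b) = 0.
      rewrite dot3_lincombl !(dot3C _ (1 *: a + _)) !dot3_lincombl.
      by rewrite (dot3C b a) aa bb -cosd d_eq cospi; ring.
    rewrite dot3E => /eqP.
    rewrite !paddr_eq0 -?expr2 ?addr_ge0 ?sqr_ge0// !sqrf_eq0.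
    move=> /andP[/andP[/eqP e0 /eqP e1] /eqP e2].
    rewrite d_eq sinpi -[RHS]addr0 -{2}ap -[LHS]add0r -ap.
    move: ap e0 e1 e2; rewrite !dot3E !mxE => ap e0 e1 e2.
    have -> : b 0 0 = - a 0 0 by lra.
    have -> : b 0 1 = - a 0 1 by lra.
    have -> : b 0 2%:R = - a 0 2%:R by lra.
    by lra.
  have sd : sin d != 0.
    by rewrite gt_eqF// sin_gt0_pi// (lt_trans ra0 ra_d)/= lt_neqAle d_neq.
  have sd2 : dot3 a b ^+ 2 = 1 - sin d ^+ 2 by rewrite -cosd cos2sin2.
  (* Gram-Schmidt: the part of [b] orthogonal to [a] has length [sin d]. *)
  exists ((- cos d / sin d) *: a + (sin d)^-1 *: b).
  split; rewrite ?(dot3C a) !dot3_lincombl.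
  - rewrite !(dot3C _ (_ *: a + _)) !dot3_lincombl (dot3C b a) aa bb cosd.
    by field: sd2.
  - by rewrite (dot3C b a) aa cosd; field.
  - by rewrite bb cosd; field: sd2.
(* The point at distance [ra] from [a] on a shortest arc to [b]; its distance to [b] is [d - ra],
   which is at most [rb]. *)
pose w := cos ra *: a + sin ra *: p.
have wa : dot3 w a = cos ra.
  by rewrite dot3_lincombl aa (dot3C p) ap; ring.
have wp : dot3 w p = sin ra by rewrite dot3_lincombl ap pp; ring.
have w1 : sphere2 w.
  apply/sphere2P; rewrite {1}/w dot3_lincombl !(dot3C _ w) wa wp -!expr2.
  by rewrite cos2Dsin2.
have wb : dot3 w b = cos (d - ra).
  by rewrite dot3_lincombl bp -cosd cosB; ring.
exists w; split; split => //; rewrite sphere_dist_leP ?wa ?wb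
  ?(ltW ra0) ?(ltW rapi) ?(ltW rb0) ?(ltW rbpi)//.
by rewrite ler_cos ?in_itv/=; lra.
Qed.

Lemma spherical_disks_meet_dist a b (ra rb : R) : sphere2 a -> sphere2 b ->
  (spherical_disk a ra `&` spherical_disk b rb) !=set0 ->
  sphere_dist a b <= ra + rb.
Proof.
move=> a1 b1 [u [[u1 ua] [_ ub]]].
by rewrite (le_trans (sphere_dist_triangle u1 a1 b1))// lerD.
Qed.

(** * Sectors of the tangent plane and the angle comparison *)

(* Up to positive factors, the cross products of the directions
   [k * pi / 3] with [(x, y)]. *)
Definition sector_forms (x y : R) : seq R :=
  let z := Num.sqrt 3 * x in [:: y; y - z; - y - z; - y; z - y; y + z; y].

(** The closed sector between directions [k] and [k.+1]; the seventh form repeats the first so that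
    sector 5 closes up. The origin lies in all six. *)
Definition in_sector (k : nat) (x y : R) : bool :=
  (sector_forms x y)`_k.+1 <= 0 <= (sector_forms x y)`_k.

Lemma in_sector_cover x y : exists k : 'I_6, in_sector k x y.
Proof.
rewrite /in_sector /=; set z := _ * x.
have ex k : (k < 6)%N ->
    [:: y; y - z; - y - z; - y; z - y; y + z; y]`_k.+1 <= 0
      <= [:: y; y - z; - y - z; - y; z - y; y + z; y]`_k ->
    exists k : 'I_6, [:: y - z; - y - z; - y; z - y; y + z; y]`_k <= 0
      <= [:: y; y - z; - y - z; - y; z - y; y + z; y]`_k.
  by move=> k6 H; exists (Ordinal k6).
(* Of the eight sign patterns for the three boundary lines, two are contradictory and each other one
   selects a sector. *)
have [y0|y0] := leP 0 y; have [h1|h1] := leP z y; have [h2|h2] := leP (- z) y.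
- by apply: (ex 1%N) => //=; lra.
- by apply: (ex 2%N) => //=; lra.
- by apply: (ex 0%N) => //=; lra.
- lra.
- lra.
- by apply: (ex 3%N) => //=; lra.
- by apply: (ex 5%N) => //=; lra.
- by apply: (ex 4%N) => //=; lra.
Qed.

(** The angle is at most pi/3, so its cosine is at least 1/2; the squared form avoids norms and
    covers zero vectors. *)
Lemma in_sector_angle (k : 'I_6) x y x' y' :
  in_sector k x y -> in_sector k x' y' ->
  0 <= x * x' + y * y' /\
  (x ^+ 2 + y ^+ 2) * (x' ^+ 2 + y' ^+ 2) <= 4 * (x * x' + y * y') ^+ 2.
Proof.
rewrite /in_sector /sector_forms /=.
have s2 : Num.sqrt 3 ^+ 2 = 3 :> R by rewrite sqr_sqrtr.
set s := Num.sqrt 3 in s2 *.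
move=> /andP[h1 h2] /andP[h3 h4].
(* With [s ^+ 2 = 3], this bounds the cross product in absolute value by [s] times the dot product.
   Lagrange's identity in the plane then gives the factor 4. *)
have [] : 0 <= (s * x) * (s * x') + 3 * (y * y')
              + ((s * x) * y' - (s * x') * y) /\
       0 <= (s * x) * (s * x') + 3 * (y * y')
              - ((s * x) * y' - (s * x') * y).
  move: h1 h2 h3 h4; move: (s * x) (s * x') => z z'.
  by case: k => [[|[|[|[|[|[|//]]]]]] ?] /= h1 h2 h3 h4; split; nra.
have -> : s * x * (s * x') = 3 * (x * x') by rewrite -s2; ring.
move=> e1 e2; have D0 : 0 <= x * x' + y * y' by lra.
split => //.
have : (s * (x * y' - x' * y)) ^+ 2 <= (3 * (x * x' + y * y')) ^+ 2.
  rewrite -ler_norm_sqr ?mulr_ge0//.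
  by rewrite ler_norml; apply/andP; split; lra.
rewrite !exprMn s2; nra.
Qed.

(** [X] and [Y] stand for the cosines of the distances from [a] and [b] to [v], and [D] for the dot
    product of the tangential parts, so [X * Y + D] is the cosine of the distance from [a] to
    [b]. *)
Lemma dot3_le_of_angle (X Y D : R) : 0 <= D -> X <= Y -> -1 <= X -> Y <= 1 ->
  (1 - X ^+ 2) * (1 - Y ^+ 2) <= 4 * D ^+ 2 -> X <= X * Y + D.
Proof.
move=> D0 XY X1 Y1 h; have [X0|X0] := leP X 0; first nra.
have XY2 : 2 * (X * (1 - Y)) <= 2 * D; last lra.
rewrite -(@ler_pXn2r _ 2)// ?nnegrE; [|nra|lra].
rewrite (_ : (2 * D) ^+ 2 = 4 * D ^+ 2); last by ring.
apply: le_trans h.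
(* The second factor is affine in [Y] with positive slope, and at [Y = X] it equals
   [(1 - X) ^+ 2 * (1 + 3 * X)]. *)
have : 0 <= (1 - Y) * ((1 - X ^+ 2) * (1 + Y) - 4 * X ^+ 2 * (1 - Y)).
  apply: mulr_ge0; first lra.
  have : 0 <= (1 - X) * (1 + 3 * X) * (1 - X) by rewrite !mulr_ge0; lra.
  have : (1 - X ^+ 2) * (1 + X) - 4 * X ^+ 2 * (1 - X) =
      (1 - X) * ((1 - X) * (1 + 3 * X)) by ring.
  have : 0 <= (Y - X) * (1 - X ^+ 2 + 4 * X ^+ 2) by rewrite mulr_ge0//; nra.
  lra.
lra.
Qed.

Lemma sphere_dist_le_max v p a b (k : 'I_6) :
  sphere2 v -> dot3 p p = 1 -> dot3 v p = 0 -> sphere2 a -> sphere2 b ->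
  in_sector k (dot3 a p) (dot3 a (cross3 v p)) ->
  in_sector k (dot3 b p) (dot3 b (cross3 v p)) ->
  sphere_dist a b <= Num.max (sphere_dist a v) (sphere_dist b v).
Proof.
move=> v1 pp vp a1 b1 ka kb.
(* The smaller cosine belongs to the point farther from [v], so [a] realizes the maximum. *)
wlog X_le_Y : a b a1 b1 ka kb / dot3 a v <= dot3 b v => [th|].
  have [h|h] := leP (dot3 a v) (dot3 b v); first exact: th.
  by rewrite sphere_distC// maxC; apply: th => //; exact: ltW.
rewrite le_max; apply/orP; left.
rewrite sphere_dist_leP// ?sphere_dist_ge0 ?sphere_dist_le_pi//.
rewrite cos_sphere_dist//.
have /sphere2P vv := v1; have /sphere2P aa := a1; have /sphere2P bb := b1.
rewrite (parseval_cross3 a b vv pp vp) -addrA.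
have [D0 D4] := in_sector_angle ka kb.
have /andP[X1 _] := dot3_unit_bounds aa vv.
have /andP[_ Y1] := dot3_unit_bounds bb vv.
apply: dot3_le_of_angle => //.
have ea := parseval_cross3 a a vv pp vp.
have eb := parseval_cross3 b b vv pp vp.
rewrite (_ : 1 - dot3 a v ^+ 2 = dot3 a p ^+ 2 + dot3 a (cross3 v p) ^+ 2);
  last by move: ea; rewrite aa; lra.
rewrite (_ : 1 - dot3 b v ^+ 2 = dot3 b p ^+ 2 + dot3 b (cross3 v p) ^+ 2) //.
by move: eb; rewrite bb; lra.
Qed.

End Sphere.

Theorem proposition4p2 (R : realType) (V : finType) (e : rel V)
    (V_nonempty : (0 < #|V|)%N) (e_simple : simple_graph e)
    (e_disk : spherical_disk_graph R e) :
  exists v : V, union_of_cliques e 6 (neighborhood e v).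
Proof.
have [c [r [c1 r_bounds eP]]] := e_disk.
have /card_gt0P[v0 _] := V_nonempty.
have [v _ r_min] := @arg_minP _ _ _ v0 xpredT r isT.
have [p [pp vp]] := exists_unit_orthogonal (c v).
(* The coordinates along [p] and [cross3 (c v) p] are those of the projection of [c w] to the
   tangent plane at [c v]. *)
pose K (k : 'I_6) : {set V} := [set w in neighborhood e v |
  in_sector k (dot3 (c w) p) (dot3 (c w) (cross3 (c v) p))]%SET.
have dist_v w : e v w -> sphere_dist (c w) (c v) <= r v + r w.
  move=> /eP[_ meet]; rewrite sphere_distC//.
  exact: spherical_disks_meet_dist.
exists v, K; split=> [k x y|].
  rewrite !inE => /andP[vx kx] /andP[vy ky] xy; apply/eP; split => //.
  apply: spherical_disks_meet => //.
  apply: le_trans (sphere_dist_le_max (c1 v) pp vp (c1 x) (c1 y) kx ky) _.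
  have := dist_v x vx; have := dist_v y vy.
  have := r_min x isT; have := r_min y isT.
  by rewrite ge_max => *; apply/andP; split; lra.
apply/setP => w; apply/idP/bigcupP => [vw|[k _]]; last by rewrite inE => /andP[].
have [k kw] := in_sector_cover (dot3 (c w) p) (dot3 (c w) (cross3 (c v) p)).
by exists k; rewrite // inE vw.
Qed.
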